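(* For every integer $n\ge 0$, one has $R_n=A(n)$ and $P_n=B(n)$, where $R_n$ and $P_n$ are the cardinalities of the sets $\mathcal{R}(n)$ and $\mathcal{P}(n)$, and $A(n)=\sum_{i\in\mathbb{Z}}a(n,i)$, $B(n)=\sum_{i\in\mathbb{Z}}b(n,i)$ for the recursively defined functions $a,b:\mathbb{Z}^2\to\mathbb{Z}$.
   Context: For an integer $n\ge 0$, let $\mathcal{Q}(n)=\{(x,y)\in\mathbb{Z}^2: 0\le x,\ 0\le y,\ x+y\le n\}$. Let $\mathcal{R}(n)$ be the set of all subsets $Y\subseteq\mathcal{Q}(n)$ such that: for any $(a,b),(c,d)\in Y$ with $\max(a,c)+\max(b,d)\le n+1$, we have $(\min(a,c),\min(b,d))\in Y$ and, additionally, $(\max(a,c),\max(b,d))\in Y$ as soon as $(\max(a,c),\max(b,d))\in\mathcal{Q}(n)$. Put $R_n=|\mathcal{R}(n)|$. Let $\mathcal{P}(n)=\{X\in\mathcal{R}(n): (0,0)\in X\}$ and $P_n=|\mathcal{P}(n)|$. The functions $a,b:\mathbb{Z}^2\to\mathbb{Z}$ are defined recursively as follows. Initial conditions for $a$: $a(n,i)=0$ if $i<0$ or $n<-2$; $a(n,i)=0$ if $n\ge 0$ and $i>n+1$; $a(n,i)=0$ if $n<0$ and $i\ne 0$; $a(-1,0)=a(-2,0)=a(0,0)=a(0,1)=1$. Initial conditions for $b$: $b(n,i)=0$ if $i\le 0$ or $i>n+1$ or $n<0$; $b(0,1)=1$. Recurrences: for $n>0$, $$a(n,0)=\sum_{i=0}^{n}a(n-1,i);$$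 for $n>0$ and $k>0$, $$a(n,k)=b(n,k)+\sum_{j=0}^{n-1} b(j,k)\sum_{i=0}^{n-j-1}a(n-j-2,i);$$ and for $n>0$ and $1\le k\le n+1$, $$b(n,k)=a(n-1,k-1)+\sum_{m=1}^{n}\ \sum_{r=0}^{\min(m-1,k-1)} a(m-2,r)\sum_{q=k-1-r}^{n-m+1} b(n-m,q).$$ *)

(* Defs.v *)
From HB Require Import structures.
From mathcomp Require Import all_boot all_order all_algebra.
From mathcomp Require Import zify.
From mathcomp Require Import classical_sets fsbigop.

Set Implicit Arguments.
Unset Strict Implicit.
Unset Printing Implicit Defensive.

Import Order.TTheory GRing.Theory Num.Theory.

Local Open Scope ring_scope.

(* Every point of the triangle Q(n) has both coordinates in {0, ..., n}, so
   that subsets of Q(n) are finite sets of pairs of ordinals below n + 1. *)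
Definition grid (n : nat) := ('I_n.+1 * 'I_n.+1)%type.

Definition Q (n : nat) : {set grid n} := [set p : grid n | (p.1 + p.2 <= n)%N].

(* [Order.min] and [Order.max] on ordinals are those of the usual order. *)
Definition pmin (n : nat) (p q : grid n) : grid n :=
  (Order.min p.1 q.1, Order.min p.2 q.2).

Definition pmax (n : nat) (p q : grid n) : grid n :=
  (Order.max p.1 q.1, Order.max p.2 q.2).

Definition Rset (n : nat) : {set {set grid n}} :=
  [set Y : {set grid n} | (Y \subset Q n) &&
    [forall p in Y, forall q in Y,
      (maxn p.1 q.1 + maxn p.2 q.2 <= n.+1)%N ==>
      (pmin p q \in Y) && ((pmax p q \in Q n) ==> (pmax p q \in Y))]].

Definition Pset (n : nat) : {set {set grid n}} :=
  [set X in Rset n | (ord0, ord0) \in X].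

(* The initial conditions and recurrences defining a and b.  Function arguments
   are computed in int.  The natural-number subtractions in the summation
   bounds never truncate: j < n, 1 <= m <= n and r <= k - 1 throughout.  The
   half-open range [lo <= i < hi.+1] renders the sum from lo to hi. *)
Record ab_system (a b : int -> int -> int) : Prop := AbSystem {
  a_out : forall n i : int, (i < 0) || (n < -2) -> a n i = 0;
  a_large : forall n i : int, 0 <= n -> n + 1 < i -> a n i = 0;
  a_neg : forall n i : int, n < 0 -> i != 0 -> a n i = 0;
  a_m1_0 : a (-1) 0 = 1;
  a_m2_0 : a (-2) 0 = 1;
  a_0_0 : a 0 0 = 1;
  a_0_1 : a 0 1 = 1;
  b_out : forall n i : int, [|| i <= 0, n + 1 < i | n < 0] -> b n i = 0;
  b_0_1 : b 0 1 = 1;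
  a_rec0 : forall n : nat, (0 < n)%N ->
    a n%:Z 0 = \sum_(0 <= i < n.+1) a (n%:Z - 1) i%:Z;
  a_rec : forall n k : nat, (0 < n)%N -> (0 < k)%N ->
    a n%:Z k%:Z = b n%:Z k%:Z +
      \sum_(0 <= j < (n - 1).+1) b j%:Z k%:Z *
        \sum_(0 <= i < (n - j - 1).+1) a (n%:Z - j%:Z - 2) i%:Z;
  b_rec : forall n k : nat, (0 < n)%N -> (1 <= k <= n + 1)%N ->
    b n%:Z k%:Z = a (n%:Z - 1) (k%:Z - 1) +
      \sum_(1 <= m < n.+1) \sum_(0 <= r < (minn (m - 1) (k - 1)).+1)
        a (m%:Z - 2) r%:Z *
        \sum_(k - 1 - r <= q < (n - m + 1).+1) b (n%:Z - m%:Z) q%:Z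
}.

(* A sum over all integers, meaningful when f n has finite support (otherwise
   it is 0 by convention); ab_system makes a n and b n vanish outside
   {0, ..., n + 1} for n >= 0. *)
Definition row_sum (f : int -> int -> int) (n : int) : int :=
  \sum_(i \in [set: int]) f n i.

(* The system is consistent: the table below is filled row by row, and the
   functions it yields solve the system. *)
Section Existence.

Let a0 (n i : int) : int :=
  if n < -2 then 0
  else if n < 0 then (i == 0)%:R else ((i == 0) || (i == 1))%:R.
Let b0 (n i : int) : int := ((n == 0) && (i == 1))%:R.

Let brow (a b : int -> int -> int) (n k : nat) : int :=
  a (n%:Z - 1) (k%:Z - 1) +
      \sum_(1 <= m < n.+1) \sum_(0 <= r < (minn (m - 1) (k - 1)).+1)
        a (m%:Z - 2) r%:Z *
        \sum_(k - 1 - r <= q < (n - m + 1).+1) b (n%:Z - m%:Z) q%:Z.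

Let brow' a b n (k : int) : int :=
  if (0 < k) && (k <= n%:Z + 1) then brow a b n `|k|%N else 0.

Let arow (a b : int -> int -> int) (n k : nat) : int :=
  brow' a b n k%:Z +
      \sum_(0 <= j < (n - 1).+1) b j%:Z k%:Z *
        \sum_(0 <= i < (n - j - 1).+1) a (n%:Z - j%:Z - 2) i%:Z.

Let arow' a b n (k : int) : int :=
  if k < 0 then 0 else if k == 0 then \sum_(0 <= i < n.+1) a (n%:Z - 1) i%:Z
  else arow a b n `|k|%N.

Fixpoint ab_table (n : nat) : (int -> int -> int) * (int -> int -> int) :=
  if n is m.+1 then
    let: (a, b) := ab_table m in
    (fun x i => if x == n%:Z then arow' a b n i else a x i,
     fun x i => if x == n%:Z then brow' a b n i else b x i)
  else (a0, b0).

Let at_ N := (ab_table N).1.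
Let bt_ N := (ab_table N).2.
Let av (n i : int) := at_ `|n|%N n i.
Let bv (n i : int) := bt_ `|n|%N n i.

Let at_S N x i :
  at_ N.+1 x i = if x == N.+1%:Z then arow' (at_ N) (bt_ N) N.+1 i else at_ N x i.
Proof. by rewrite /at_ /bt_ /=; case: (ab_table N). Qed.

Let bt_S N x i :
  bt_ N.+1 x i = if x == N.+1%:Z then brow' (at_ N) (bt_ N) N.+1 i else bt_ N x i.
Proof. by rewrite /at_ /bt_ /=; case: (ab_table N). Qed.

Let at_neg N x i : x < 0 -> at_ N x i = a0 x i.
Proof.
move=> x0; elim: N => // N IH; rewrite at_S ifF //; apply/eqP; lia.
Qed.

Let bt_neg N x i : x < 0 -> bt_ N x i = b0 x i.
Proof.
move=> x0; elim: N => // N IH; rewrite bt_S ifF //; apply/eqP; lia.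
Qed.

Let at_le N x i : x <= N%:Z -> at_ N x i = av x i.
Proof.
have [x0 _|x0] := ltP x 0; first by rewrite /av !at_neg.
elim: N => [|N IH] xN; first by have -> : x = 0 by lia.
rewrite at_S; case: eqP => [->|ne]; first by rewrite /av absz_nat at_S eqxx.
by apply: IH; lia.
Qed.

Let bt_le N x i : x <= N%:Z -> bt_ N x i = bv x i.
Proof.
have [x0 _|x0] := ltP x 0; first by rewrite /bv !bt_neg.
elim: N => [|N IH] xN; first by have -> : x = 0 by lia.
rewrite bt_S; case: eqP => [->|ne]; first by rewrite /bv absz_nat bt_S eqxx.
by apply: IH; lia.
Qed.

Let brow_le N k : brow (at_ N) (bt_ N) N.+1 k = brow av bv N.+1 k.
Proof.
rewrite /brow at_le; last by lia.
congr (_ + _); apply: eq_big_nat => m Hm; apply: eq_big_nat => r _.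
rewrite at_le; last by lia.
congr (_ * _); apply: eq_big_nat => q _; apply: bt_le; lia.
Qed.

Let bvS (n : nat) k : bv n.+1%:Z k = brow' av bv n.+1 k.
Proof. by rewrite /bv absz_nat bt_S eqxx /brow' brow_le. Qed.

Let avS (n : nat) k : av n.+1%:Z k = arow' av bv n.+1 k.
Proof.
rewrite /av absz_nat at_S eqxx /arow'; case: ifP => // _; case: ifP => _.
  by apply: eq_big_nat => i _; apply: at_le; lia.
rewrite /arow /brow' brow_le; congr (_ + _).
apply: eq_big_nat => j Hj; rewrite bt_le; last by lia.
by congr (_ * _); apply: eq_big_nat => i _; apply: at_le; lia.
Qed.

Let bv_out n i : [|| i <= 0, n + 1 < i | n < 0] -> bv n i = 0.
Proof.
have [n0 _|n0] := ltP n 0.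
  by rewrite /bv bt_neg // /b0; case: eqP => // n0'; lia.
case: n n0 => // -[|n] _ H.
  by rewrite /bv /= /bt_ /= /b0; case: eqP => //=; case: eqP => // i1; lia.
by rewrite bvS /brow' ifF //; lia.
Qed.

Lemma ab_system_consistent : exists a b, ab_system a b.
Proof.
exists av, bv; split => //.
- move=> n i H; have [n0|n0] := ltP n 0.
    rewrite /av at_neg // /a0 n0; case: ifP => // n2.
    by case: eqP => // i0; lia.
  case: n n0 H => // -[|n] _ H; last by rewrite avS /arow' ifT //; lia.
  by rewrite /av /at_ /= /a0 /=; do 2![case: eqP => [?|_]; first by lia].
- case=> // -[|n] i _ H.
    by rewrite /av /at_ /= /a0 /=; do 2![case: eqP => [?|_]; first by lia].
  rewrite avS /arow' !ifF; [|lia|lia].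
  rewrite /arow /brow' ifF; last by lia.
  rewrite add0r big_nat_cond big1 // => j /andP[Hj _].
  by rewrite bv_out ?mul0r //; lia.
- move=> n i n0 i0; rewrite /av at_neg // /a0 n0; case: ifP => // _.
  by rewrite (negbTE i0).
- by case=> // n _; rewrite avS /arow' /=; apply: eq_big_nat => i _; congr av; lia.
- by case=> // n [] // k _ _; rewrite avS bvS.
- case=> // n k _ Hk; rewrite bvS /brow' ifT; last by lia.
  by rewrite absz_nat.
Qed.

End Existence.

(* Main.v *)
(* Write N = n + 1, and let F(N, k) and G(N, k) be the numbers of sets Y in R(n)
   with k points in the bottom row y = 0, the latter counting only those that
   contain (0, 0).  These satisfy the recurrences of a(n, k) and b(n, k).
   - If the bottom row is empty, Y is a set in R(n - 1) moved up by one.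
   - Otherwise let (c, 0) be its first point.  For x < c and 0 < y <= N - c, the
     minimum of (x, y) and (c, 0) would be an earlier point of the bottom row;
     hence Y is the disjoint union of a set in P(n - c), moved by (c, 0), and an
     unconstrained set in R(c - 2), moved by (0, N - c + 1).
   - If (0, 0) is in Y and nothing else is in the column x = 0, the rest of Y is
     a set in R(n - 1) moved right by one.
   - Otherwise let (0, m) be the lowest point of the column with m > 0, and
     e = N - m.  Above height m lies a set U in P(n - m), and in x > e, y < m a
     set in R(m - 2).  Besides these Y has only points (x, 0) with x <= e, and
     the abscissas of these form an initial segment of T u {e}, where T is the
     bottom row of U; so they are determined by their number, which is at most
     |T| + 1. *)
Require Import Defs.
From mathcomp Require Import boolp classical_sets fsbigop.
From mathcomp Require Import all_boot all_order all_algebra.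
From mathcomp Require Import zify.

Set Implicit Arguments.
Unset Strict Implicit.
Unset Printing Implicit Defensive.

Local Open Scope nat_scope.

(** * Counting finite sets, and ranks and first elements in initial ranges *)

Lemma card_bij (T1 T2 : finType) (A : {set T1}) (B : {set T2})
    (f : T1 -> T2) (g : T2 -> T1) :
  {in A, forall x, f x \in B} -> {in B, forall y, g y \in A} ->
  {in A, cancel f g} -> {in B, cancel g f} -> #|A| = #|B|.
Proof.
move=> fB gA fK gK; rewrite -(card_in_imset (can_in_inj fK)).
apply: eq_card => y; apply/imsetP/idP => [[x xA ->]|yB]; first exact: fB.
by exists (g y); rewrite ?gK ?gA.
Qed.

Lemma card_fibers (T : finType) (A : {set T}) (h : T -> nat) (K L : nat) :
  {in A, forall x, K <= h x < L} ->
  #|A| = \sum_(K <= i < L) #|[set x in A | h x == i]|.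
Proof.
move=> hL; rewrite -sum1_card.
transitivity (\sum_(x in A) \sum_(K <= i < L | h x == i) 1).
  apply: eq_bigr => x /hL xL.
  rewrite sum1_count (eq_count (eq_sym _)) count_uniq_mem ?iota_uniq //.
  by rewrite mem_index_iota xL.
rewrite (exchange_big_dep xpredT) //=; apply: eq_bigr => i _.
by rewrite -sum1_card; apply: eq_bigl => x; rewrite inE.
Qed.

Definition cnt (P : nat -> bool) (L : nat) : nat := count P (iota 0 L).

Lemma cntS P L : cnt P L.+1 = cnt P L + P L.
Proof. by rewrite /cnt -addn1 iotaD count_cat /= add0n addn0. Qed.

Lemma cntD P L M : cnt P (L + M) = cnt P L + cnt (fun x => P (L + x)) M.
Proof. by elim: M => [|M IH]; rewrite ?addn0 // addnS !cntS IH addnA. Qed.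

Lemma eq_cnt P S L : (forall x, x < L -> P x = S x) -> cnt P L = cnt S L.
Proof.
by elim: L => // L IH PS; rewrite !cntS PS // IH // => x xL; apply/PS/ltnW.
Qed.

Lemma cnt0P P L : reflect (forall x, x < L -> P x = false) (cnt P L == 0).
Proof.
rewrite /cnt -leqn0 leqNgt -has_count -all_predC; apply: (iffP allP) => H x;
  first move=> xL.
  by apply/negbTE/H; rewrite mem_iota.
by rewrite mem_iota add0n /= => /H->.
Qed.

Lemma leq_cnt P L : cnt P L <= L.
Proof. by rewrite -[X in _ <= X](size_iota 0) count_size. Qed.

Lemma leq_cntr P L M : L <= M -> cnt P L <= cnt P M.
Proof. by move=> /subnK <-; rewrite addnC cntD leq_addr. Qed.

(** For a point [x] of [P], [cnt P x] is its rank, so the extra condition keeps exactly the first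
    [s] points. *)
Lemma cnt_truncate P s L :
  cnt (fun x => P x && (cnt P x < s)) L = minn s (cnt P L).
Proof.
elim: L => [|L IH]; first by rewrite /cnt minn0.
by rewrite !cntS IH; case: (P L) => /=; lia.
Qed.

(** An initial segment of [P] is determined by its size: it consists of the points whose rank is
    below that size. This is why the short bottom piece in [glue_above] can be encoded by the number
    [s] alone. *)
Lemma initial_segment_rank (P S : nat -> bool) L :
  (forall x, x < L -> S x -> P x) ->
  (forall x z, x < L -> S x -> P z -> z < x -> S z) ->
  forall x, x < L -> S x = P x && (cnt P x < cnt S L).
Proof.
move=> SP Sdown x xL.
case Px: (P x); last by apply/negbTE/negP => /(SP x xL); rewrite Px.
case Sx: (S x) => /=.
  rewrite (@eq_cnt P S); last first.
    move=> z zx; case Pz: (P z); first by rewrite (Sdown x).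
    by apply/esym/negbTE/negP => /(SP z (ltn_trans zx xL)); rewrite Pz.
  have := leq_cntr S xL; rewrite cntS Sx; lia.
(* Now [x] is in [P] but not in [S]. By downward closure [S] has no point beyond [x], so its size is
   at most the rank of [x] in [P]. *)
have -> : L = x + (L - x) by lia.
rewrite cntD (_ : cnt _ (L - x) = 0) ?addn0; last first.
  apply/eqP/cnt0P => z zL; apply/negbTE/negP => Sz.
  have [z0|z0] := posnP z; first by move: Sz; rewrite z0 addn0 Sx.
  by move: Sx; rewrite (Sdown (x + z) x) //; lia.
apply/esym/negbTE; rewrite -leqNgt (@eq_cnt S (fun z => S z && P z)).
  by apply: sub_count => z /andP[].
by move=> z zx; case Sz: (S z) => //=; rewrite (SP z) // (ltn_trans zx).
Qed.

(* Equal to [L] when [P] holds nowhere below [L]. *)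
Definition first (P : nat -> bool) (L : nat) : nat := find P (iota 0 L).

Lemma first_leq P L : first P L <= L.
Proof. by rewrite -[X in _ <= X](size_iota 0) find_size. Qed.

Lemma before_first P L x : x < first P L -> P x = false.
Proof.
move=> xf; have xL := leq_trans xf (first_leq P L).
by have := before_find 0 xf; rewrite nth_iota.
Qed.

Lemma first_true P L : first P L < L -> P (first P L).
Proof.
move=> fL; have := @nth_find _ 0 P (iota 0 L); rewrite nth_iota // add0n.
by apply; rewrite has_find size_iota.
Qed.

Lemma firstP (P : nat -> bool) L c : c < L ->
  reflect (P c /\ forall x, x < c -> P x = false) (first P L == c).
Proof.
move=> cL; apply: (iffP eqP) => [fc|[Pc Pb]].
  by split=> [|x]; rewrite -fc;
    [apply: first_true; rewrite fc | apply: before_first].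
apply/eqP; rewrite eqn_leq; apply/andP; split; rewrite leqNgt; apply/negP.
  by move/before_first; rewrite Pc.
by move=> fc; have := first_true (ltn_trans fc cL); rewrite Pb.
Qed.

Lemma first_noneP (P : nat -> bool) L :
  reflect (forall x, x < L -> P x = false) (first P L == L).
Proof.
apply: (iffP eqP) => [fL x xL|H]; 
  first by apply: (@before_first _ L); rewrite fL.
have := first_leq P L; rewrite leq_eqVlt => /orP[/eqP//|fL].
by have := first_true fL; rewrite H.
Qed.

(** * Stable predicates on the quarter plane, and their gluing and splitting *)

(* The closure condition of R(n), for N = n + 1: it is void for comparable
   points, so only a pair with (z, t) to the lower right of (x, y) matters. *)
Definition stable (N : nat) (P : nat -> nat -> bool) : Prop :=
  (forall x y, P x y -> x + y < N) /\
  (forall x y z t, x < z -> t < y -> P x y -> P z t -> z + y <= N ->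
     P x t /\ (z + y < N -> P z y)).

Lemma stable_shift c d M N P : M = N - (c + d) ->
  stable N P -> stable M (fun x y => P (c + x) (d + y)).
Proof.
move=> -> [sup clo]; split=> [x y /sup|x y z t xz ty Pxy Pzt le]; first lia.
by have := clo _ _ _ _ _ _ Pxy Pzt; lia.
Qed.

(* [V] is placed at (c, 0) and [W] at (0, j + 2). *)
Definition glue_right c j (V W : nat -> nat -> bool) x y : bool :=
  (c <= x) && V (x - c) y || (j.+2 <= y) && W x (y - j.+2).

(** The two pieces do not interact: a point of the right piece is too low to lie above one of the
    left piece, and a left point with a right point to its lower right gives
    [z + y >= c + j + 2 > N]. *)
Lemma stable_glue_right c j V W : 0 < c ->
  stable j.+1 V -> stable c.-1 W -> stable (c + j.+1) (glue_right c j V W).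
Proof.
move=> c0 [supV cloV] [supW cloW]; split=> [x y|x y z t xz ty].
  by case/orP=> /andP[? H]; [have := supV _ _ H|have := supW _ _ H]; lia.
case/orP=> /andP[? Hx] /orP[] /andP[? Hz] le.
- have [||A B] := cloV _ _ _ _ _ ty Hx Hz; try lia.
  rewrite /glue_right; split; first by apply/orP; left; apply/andP.
  by move=> lt; apply/orP; left; rewrite B ?andbT; lia.
- by have := supV _ _ Hx; lia.
- lia.
- have [||A B] := cloW _ _ _ _ xz _ Hx Hz; try lia.
  rewrite /glue_right; split; first by apply/orP; right; apply/andP.
  by move=> lt; apply/orP; right; rewrite B ?andbT; lia.
Qed.

Lemma glue_right_split c j P : stable (c + j.+1) P -> P c 0 ->
  (forall x, x < c -> P x 0 = false) ->
  glue_right c j (fun x y => P (c + x) y) (fun x y => P x (j.+2 + y)) =2 P.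
Proof.
move=> [sup clo] Pc0 Pb x y; rewrite /glue_right.
have [cx|xc] := leqP c x.
  by rewrite subnKC //=; case: (leqP j.+2 y) => [jy|_] /=;
    rewrite ?orbF ?subnKC ?orbb.
have [jy|yj] := leqP j.+2 y; rewrite /= ?subnKC //.
apply/esym/negbTE/negP => Pxy.
have [y0|y0] := posnP y; first by move: Pxy; rewrite y0 Pb.
have [|] := clo _ _ _ _ xc y0 Pxy Pc0; first lia.
by rewrite Pb.
Qed.

Lemma split_glue_right c j V W : 0 < c -> stable j.+1 V -> stable c.-1 W ->
  ((fun x y => glue_right c j V W (c + x) y) =2 V) *
  ((fun x y => glue_right c j V W x (j.+2 + y)) =2 W).
Proof.
move=> c0 [supV _] [supW _]; rewrite /glue_right; split=> x y.
  rewrite leq_addr addKn /=; case: (boolP (W _ _));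
    rewrite ?andbF ?orbF // => /supW; lia.
rewrite leq_addr addKn /=; case: (boolP (V _ _));
  rewrite ?andbF ?orbF // => /supV; lia.
Qed.

Definition glue_column (V : nat -> nat -> bool) x y : bool :=
  if x is x'.+1 then V x' y else y == 0.

Lemma stable_glue_column N V : stable N V -> stable N.+1 (glue_column V).
Proof.
move=> [sup clo]; split=> [[|x] [|y] //= /sup|]; try lia.
move=> [|x] y [|z] t //= xz ty Hx Hz le; first by move: ty; rewrite (eqP Hx).
by have := clo _ _ _ _ _ ty Hx Hz; lia.
Qed.

(* [U] is placed at (0, m), [W] at (e + 1, 0), and the [s] points (x, 0) with
   x <= e are the first ones of the bottom row of [U] completed by [e]. *)
Definition glue_above m e s (U W : nat -> nat -> bool) x y : bool :=
  if m <= y then U x (y - m) else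
  if e < x then W (x - e.+1) y else
  [&& y == 0, U x 0 || (x == e) & cnt (fun z => U z 0 || (z == e)) x < s].

(** A point at height at least [m] and one with abscissa beyond [e] have [z + y > m + e], so no
    condition links [U] and [W]. The only new pairs join a point of [U] to a bottom point (z, 0)
    with [z <= e]. *)
Lemma stable_glue_above m e s U W : 0 < m ->
  stable e U -> stable m.-1 W -> stable (m + e) (glue_above m e s U W).
Proof.
move=> m0 [supU cloU] [supW cloW]; rewrite /glue_above;
  split=> [x y|x y z t xz ty].
  case: (leqP m y) => my; first by move/supU; lia.
  case: (leqP e.+1 x) => ex; first by move/supW; lia.
  by case/and3P=> /eqP->; lia.
case: (leqP m y) => my; case: (leqP m t) => mt; try lia.
- by move=> Hx Hz le; have := cloU _ _ _ _ xz _ Hx Hz; lia.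
- case: (leqP e.+1 z) => ez Hx; first by lia.
  case/and3P=> /eqP t0 Tz zs le; have -> : e < x = false by lia.
  (* The rank bound passes from [z] to the smaller [x]; it remains to see that [x] is in the bottom
     row of [U]. *)
  rewrite t0 eqxx /= (leq_ltn_trans (leq_cntr _ (ltnW xz)) zs) andbT.
  (* If [z = e], then [z + y <= m + e] forces [y = m], so (x, y) itself is in that row, and the
     maximum lies outside the triangle. *)
  case/orP: Tz => [Uz|/eqP ze]; last first.
    by split; [apply/orP; left; move: Hx; have -> : y - m = 0 by lia | lia].
  have [ym|ym] := posnP (y - m); first by rewrite ym in Hx *; rewrite Hx.
  have [|A B] := cloU _ _ _ _ xz ym Hx Uz; first lia.
  by rewrite A; split=> // lt; apply: B; lia.
- case: (leqP e.+1 x) => ex; last by case/and3P=> /eqP y0; lia.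
  have ez : e < z by lia.
  by rewrite ez => Hx Hz le; have := cloW _ _ _ _ _ ty Hx Hz; lia.
Qed.

(** Pairs with (0, m) do most of the work. A point (x, y) with [x <= e] and [0 < y < m] would have
    minimum (0, y) with it. For a bottom point (z, 0) with [z < e] the maximum (z, m) is present;
    for [z = e] it falls outside the triangle, which is why [e] is adjoined to the row of [U].
    Minima with points of height [m] show that the bottom points up to [e] form an initial
    segment. *)
Lemma glue_above_split m e P : 0 < m -> stable (m + e) P -> P 0 0 -> P 0 m ->
  (forall y, 0 < y < m -> P 0 y = false) ->
  glue_above m e (cnt (P ^~ 0) e.+1)
    (fun x y => P x (m + y)) (fun x y => P (e.+1 + x) y) =2 P.
Proof.
move=> m0 [sup clo] P00 P0m Pb x y; rewrite /glue_above.
case: (leqP m y) => my; first by rewrite subnKC.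
case: (leqP e.+1 x) => ex; first by rewrite subnKC.
have [->|y0] /= := posnP y; last first.
  apply/esym/negbTE/negP => Pxy.
  have [x0|x0] := posnP x; first by move: Pxy; rewrite x0 Pb // y0.
  by have [|] := clo _ _ _ _ x0 my P0m Pxy; [lia|rewrite Pb // y0].
rewrite addn0; apply/esym/initial_segment_rank => // z.
  rewrite ltnS leq_eqVlt orbC => /orP[ze Pz|/eqP->]; last by rewrite eqxx orbT.
  have [->|z0] := posnP z; first by rewrite P0m.
  by have [|_ ->] := clo _ _ _ _ z0 m0 P0m Pz; lia.
move=> w ze Pz /orP[Pw|/eqP->] wz; last lia.
by have [|] := clo _ _ _ _ wz m0 Pw Pz; lia.
Qed.

Lemma split_glue_above m e s U W : 0 < m -> stable e U -> stable m.-1 W ->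
  ((fun x y => glue_above m e s U W x (m + y)) =2 U) *
  ((fun x y => glue_above m e s U W (e.+1 + x) y) =2 W).
Proof.
move=> m0 [supU _] [supW _]; rewrite /glue_above; split=> x y.
  by rewrite leq_addr addKn.
rewrite leq_addr addKn; case: leqP => // my.
case: (boolP (U _ _)) => [/supU|_]; first lia.
by apply/esym/negbTE/negP => /supW; lia.
Qed.

Lemma cnt_glue_above m e s U W : 0 < m ->
  cnt (glue_above m e s U W ^~ 0) e.+1 = minn s (cnt (U ^~ 0) e).+1.
Proof.
move=> m0; set T := fun z => U z 0 || (z == e).
rewrite (@eq_cnt _ (fun x => T x && (cnt T x < s))); last first.
  by move=> x xe; rewrite /glue_above leqNgt m0 /= ltnNge -ltnS xe.
rewrite cnt_truncate cntS /T eqxx orbT (@eq_cnt _ (U ^~ 0)) ?addn1 //.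
by move=> x xe; rewrite (ltn_eqF xe) orbF.
Qed.

(** * Passage between subsets of the grid and predicates on pairs of naturals *)

(** The bounds guard against [inord], which sends every value above [n] to 0. *)
Definition pt n (Y : {set grid n}) (x y : nat) : bool :=
  [&& x <= n, y <= n & ((inord x, inord y) : grid n) \in Y].

Definition region n (P : nat -> nat -> bool) : {set grid n} :=
  [set p : grid n | P p.1 p.2].

Lemma ptE n (Y : {set grid n}) (p : grid n) : pt Y p.1 p.2 = (p \in Y).
Proof. by rewrite /pt !leq_ord !inord_val -surjective_pairing. Qed.

Lemma pt_inj n : injective (@pt n).
Proof. by move=> Y Z YZ; apply/setP => p; rewrite -!ptE YZ. Qed.

Lemma regionK n N P : N <= n.+1 -> stable N P -> pt (region n P) = P.
Proof.
move=> Nn [sup _]; apply/funext => x; apply/funext => y; rewrite /pt inE /=.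
case Pxy: (P x y); last first.
  by case: leqP => //= xn; case: leqP => //= yn; rewrite !inordK ?ltnS.
have := sup _ _ Pxy => lt.
have xn : x <= n by lia.
have yn : y <= n by lia.
by rewrite xn yn !inordK.
Qed.

(** The grid stays fixed while [N] ranges up to [n.+1], so that all sizes occurring in the
    recurrences are counted inside one finite type. *)
Definition stable_sets n N : {set {set grid n}} :=
  [set Y | `[< stable N (pt Y) >]].

Lemma stable_setsP n N (Y : {set grid n}) :
  reflect (stable N (pt Y)) (Y \in stable_sets n N).
Proof. by rewrite inE; apply: asboolP. Qed.

Definition rowsize n (Y : {set grid n}) N : nat := cnt (pt Y ^~ 0) N.

Definition Fset n N k := [set Y in stable_sets n N | rowsize Y N == k].
Definition Gset n N k := [set Y in Fset n N k | pt Y 0 0].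

Lemma val_min_ord m (i j : 'I_m) : Order.min i j = minn i j :> nat.
Proof. by rewrite Order.POrderTheory.minEle Order.OrdinalOrder.leEord;
  case: leqP. Qed.

Lemma val_max_ord m (i j : 'I_m) : Order.max i j = maxn i j :> nat.
Proof. by rewrite Order.POrderTheory.maxEle Order.OrdinalOrder.leEord;
  case: leqP. Qed.

Lemma pt_grid n (Y : {set grid n}) x y :
  pt Y x y -> exists p : grid n, [/\ p \in Y, x = p.1 & y = p.2].
Proof.
by case/and3P=> xn yn pY; exists (inord x, inord y); rewrite /= !inordK.
Qed.

Lemma Rset_stable n : Rset n = stable_sets n n.+1.
Proof.
apply/setP => Y; rewrite inE; apply/andP/stable_setsP => [[sub clo]|[sup clo]].
  split=> [x y /pt_grid[p [pY -> ->]]|x y z t].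
    by have := subsetP sub _ pY; rewrite inE ltnS.
  move=> xz ty /pt_grid[p [pY ? ?]] /pt_grid[q [qY ? ?]] le; subst x y z t.
  have /forall_inP/(_ _ qY)/implyP := forall_inP clo _ pY.
  rewrite -!(ptE Y) inE /= !val_min_ord !val_max_ord.
  rewrite (maxn_idPr (ltnW xz)) (maxn_idPl (ltnW ty)).
  rewrite (minn_idPl (ltnW xz)) (minn_idPr (ltnW ty)).
  by move/(_ le)/andP=> [-> /implyP H]; split=> // /H.
split; first by apply/subsetP => p; rewrite -(ptE Y) inE => /sup; rewrite ltnS.
apply/forall_inP => p pY; apply/forall_inP => q qY; apply/implyP => le.
rewrite -!(ptE Y) inE /= !val_min_ord !val_max_ord.
move: pY qY; rewrite -!(ptE Y) => pY qY.
(* Either the points are comparable, and their minimum and maximum are the points themselves, or one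
   of them is strictly to the lower right of the other. *)
have [p1|q1] := ltnP p.1 q.1; have [p2|q2] := leqP p.2 q.2;
  rewrite ?pY ?qY ?implybT //.
- by have := clo _ _ _ _ p1 q2 pY qY; lia.
- case: (ltngtP q.1 p.1) q1 => // [q1|q1] _.
    case: (ltngtP p.2 q.2) p2 => // [p2|p2] _;
      last by rewrite -p2 pY implybT p2 qY.
    by have := clo _ _ _ _ q1 p2 qY pY; lia.
  by rewrite q1 pY -q1 qY implybT.
Qed.

(** * Recurrences for the numbers of stable sets *)

Section Counting.

Variable n : nat.
Implicit Types (N k : nat) (Y V W U : {set grid n}).

Lemma stable_sets0 : stable_sets n 0 = [set set0].
Proof.
apply/setP => Y; rewrite in_set1; apply/stable_setsP/eqP => [[sup _]|->].
  by apply/setP => p; rewrite inE; apply/negbTE/negP; rewrite -ptE => /sup.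
by split=> [x y|x y z t _ _]; rewrite /pt inE !andbF.
Qed.

Lemma FsetP N k Y :
  reflect (stable N (pt Y) /\ rowsize Y N = k) (Y \in Fset n N k).
Proof.
rewrite inE; apply: (iffP andP) => [[/stable_setsP ? /eqP]|[? <-]] //.
by split=> //; apply/stable_setsP.
Qed.

Lemma GsetP N k Y :
  reflect [/\ stable N (pt Y), rowsize Y N = k & pt Y 0 0] (Y \in Gset n N k).
Proof.
by rewrite inE; apply: (iffP andP) => [[/FsetP[]]|[? ? ?]] //; split=> //;
  apply/FsetP.
Qed.

Lemma card_stable_sets N :
  #|stable_sets n N| = \sum_(0 <= k < N.+1) #|Fset n N k|.
Proof. by apply: card_fibers => Y _; rewrite ltnS leq_cnt. Qed.

Lemma card_Fset0 N : N <= n -> #|Fset n N.+1 0| = #|stable_sets n N|.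
Proof.
move=> Nn;
  pose up (P : nat -> nat -> bool) x y := if y is y'.+1 then P x y' else false.
have up_stable P : stable N P -> stable N.+1 (up P).
  move=> [sup clo]; split=> [x [|y] //= /sup|x [|y] z [|t] //= xz ty Px Pz];
    first lia.
  by have := clo _ _ _ _ xz _ Px Pz; lia.
have down_stable P : stable N.+1 P -> stable N (fun x y => P (0 + x) (1 + y)).
  by apply: stable_shift; rewrite subn1.
have Nn1 := leqW Nn.
apply: (@card_bij _ _ _ _ (fun Y => region n (fun x y => pt Y (0 + x) (1 + y)))
    (fun Z => region n (up (pt Z)))).
- move=> Y /FsetP[sY _]; apply/stable_setsP;
    rewrite (regionK Nn1 (down_stable _ sY)).
  exact: down_stable.
- move=> Z /stable_setsP sZ; have sU := up_stable _ sZ.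
  apply/FsetP; rewrite /rowsize (regionK (Nn : N.+1 <= n.+1) sU).
  by split=> //; apply/eqP/cnt0P.
- move=> Y /FsetP[sY /eqP/cnt0P row0]; have sD := down_stable _ sY.
  apply: pt_inj;
    rewrite (regionK Nn1 sD) (regionK (Nn : N.+1 <= n.+1) (up_stable _ sD)).
  apply/funext => x; apply/funext => -[|y] //=; apply/esym/negbTE/negP => Yx.
  by move: (Yx); rewrite row0 //; have := sY.1 _ _ Yx; lia.
- move=> Z /stable_setsP sZ; have sU := up_stable _ sZ.
  by apply: pt_inj;
    rewrite (regionK (Nn : N.+1 <= n.+1) sU) (regionK Nn1 (down_stable _ sU)).
Qed.

Definition first_column Y N : nat := first (pt Y ^~ 0) N.

(** All [k] bottom points have abscissa at least [c], hence belong to the right factor, so [k] is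
    passed on unchanged. *)
Lemma card_Fset_fiber c j k : 0 < c -> 0 < k -> c + j.+1 <= n.+1 ->
  #|[set Y in Fset n (c + j.+1) k | first_column Y (c + j.+1) == c]| =
  #|Gset n j.+1 k| * #|stable_sets n c.-1|.
Proof.
move=> c0 k0 Nn; rewrite -cardsX; set N := c + j.+1.
have jn : j.+1 <= n.+1 by lia.
have cn : c.-1 <= n.+1 by lia.
have cN : c < N by rewrite /N; lia.
have right_stable P : stable N P -> stable j.+1 (fun x y => P (c + x) y).
  by apply: (@stable_shift c 0); rewrite /N; lia.
have left_stable P : stable N P -> stable c.-1 (fun x y => P x (j.+2 + y)).
  by apply: (@stable_shift 0 j.+2); rewrite /N; lia.
apply: (@card_bij _ _ _ _
  (fun Y => (region n (fun x y => pt Y (c + x) y),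
             region n (fun x y => pt Y x (j.+2 + y))))
  (fun p => region n (glue_right c j (pt p.1) (pt p.2)))).
- move=> Y; rewrite inE => /andP[/FsetP[sY kY] /(firstP _ cN)[Yc Yb]].
  have sV := right_stable _ sY; have sW := left_stable _ sY.
  rewrite inE /=; apply/andP; split; last first.
    by apply/stable_setsP; rewrite (regionK cn sW).
  apply/GsetP; rewrite /rowsize (regionK jn sV); split=> //;
    last by rewrite addn0.
  by rewrite -kY /rowsize cntD; have /cnt0P/eqP -> := Yb.
- move=> [V W]; rewrite inE /= => /andP[/GsetP[sV kV V0] /stable_setsP sW].
  have sY := stable_glue_right c0 sV sW.
  rewrite inE /first_column; apply/andP; split.
    apply/FsetP; rewrite /rowsize (regionK Nn sY); split=> //.
    rewrite cntD (_ : cnt _ c = 0) ?add0n; last first.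
      by apply/eqP/cnt0P => x xc; rewrite /glue_right leqNgt xc.
    by rewrite -kV; apply: eq_cnt => x _; rewrite (split_glue_right c0 sV sW).1.
  rewrite (regionK Nn sY); apply/(firstP _ cN).
  rewrite /glue_right leqnn subnn V0; split=> // x xc.
  by rewrite leqNgt xc.
- move=> Y; rewrite inE => /andP[/FsetP[sY kY] /(firstP _ cN)[Yc Yb]].
  have sV := right_stable _ sY; have sW := left_stable _ sY.
  apply: pt_inj; rewrite /= (regionK jn sV) (regionK cn sW).
  have splitY : glue_right c j (fun x y => pt Y (c + x) y)
      (fun x y => pt Y x (j.+2 + y)) = pt Y.
    by apply/funext => x; apply/funext => y; exact: glue_right_split.
  by rewrite splitY (regionK Nn sY).
- move=> [V W]; rewrite inE /= => /andP[/GsetP[sV kV V0] /stable_setsP sW].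
  have sY := stable_glue_right c0 sV sW.
  congr (_, _); apply: pt_inj; rewrite (regionK Nn sY).
    rewrite (regionK jn (right_stable _ sY)).
    by apply/funext => x; apply/funext => y;
      rewrite (split_glue_right c0 sV sW).
  rewrite (regionK cn (left_stable _ sY)).
  by apply/funext => x; apply/funext => y; rewrite (split_glue_right c0 sV sW).
Qed.

Lemma card_Fset N k : 0 < k -> N <= n.+1 ->
  #|Fset n N k| = #|Gset n N k| +
    \sum_(0 <= j < N.-1) #|Gset n j.+1 k| * #|stable_sets n (N - j).-2|.
Proof.
move=> k0 Nn; case: N Nn => [_|N Nn].
  rewrite big_nil addn0; apply/eq_card => Y.
  apply/FsetP/GsetP => [[_ Y0]|[] //].
  by move: k0; rewrite -Y0.
rewrite (@card_fibers _ _ (fun Y => N - first_column Y N.+1) 0 N.+1);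
  last first.
  by move=> Y _ /=; rewrite ltnS leq_subr.
have fiber j : j <= N ->
    [set Y in Fset n N.+1 k | N - first_column Y N.+1 == j] =
    [set Y in Fset n N.+1 k | first_column Y N.+1 == N - j].
  move=> jN; apply/setP => Y; rewrite [LHS]inE [RHS]inE;
    apply: andb_id2l => /FsetP[_ kY].
  (* An empty bottom row has [first_column] equal to [N.+1], which truncated subtraction would
     confuse with column [N]; [0 < k] excludes it. *)
  have := first_leq (pt Y ^~ 0) N.+1;
    rewrite leq_eqVlt => /orP[/first_noneP row0|].
    by move: k0; rewrite -kY lt0n => /negP[]; apply/cnt0P.
  by rewrite -/(first_column _ _); lia.
rewrite big_nat_recr //= addnC; congr (_ + _).
  rewrite fiber // subnn; apply: eq_card => Y; rewrite [LHS]inE [RHS]inE;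
    apply: andb_id2l => _.
  rewrite /first_column; apply/(firstP _ (ltn0Sn N))/idP => [[]//|]; by split.
apply: eq_big_nat => j /andP[_ jN]; rewrite fiber ?(ltnW jN) //.
rewrite (_ : (N.+1 - j).-2 = (N - j).-1); last by lia.
rewrite -card_Fset_fiber //; [|lia|lia].
by rewrite (_ : N - j + j.+1 = N.+1) //; lia.
Qed.

(** This is m - 1 for the lowest point (0, m) with m > 0, and [N] if there is none below height
    [N.+1]. *)
Definition column_gap Y N : nat := first (fun y => pt Y 0 y.+1) N.

Lemma card_Gset_column N k : N <= n -> 0 < k ->
  #|[set Y in Gset n N.+1 k | column_gap Y N == N]| = #|Fset n N k.-1|.
Proof.
move=> Nn k0; have Nn1 := leqW Nn.
have down_stable P : stable N.+1 P -> stable N (fun x y => P (1 + x) (0 + y)).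
  by apply: stable_shift; rewrite subn1.
apply: (@card_bij _ _ _ _ (fun Y => region n (fun x y => pt Y (1 + x) (0 + y)))
    (fun V => region n (glue_column (pt V)))).
- move=> Y; rewrite inE => /andP[/GsetP[sY kY Y0] _].
  apply/FsetP; rewrite /rowsize (regionK Nn1 (down_stable _ sY)); split.
    exact: down_stable.
  by rewrite -kY /rowsize -[N.+1]add1n cntD cntS /cnt /= Y0.
- move=> V /FsetP[sV kV]; have sY := stable_glue_column sV.
  rewrite inE /column_gap; apply/andP; split.
    apply/GsetP; rewrite /rowsize (regionK (Nn : N.+1 <= n.+1) sY); split=> //.
    rewrite -[N.+1]add1n cntD cntS {1}/cnt /= -[RHS](prednK k0) -kV.
    by rewrite add0n add1n.
  by rewrite (regionK (Nn : N.+1 <= n.+1) sY); apply/first_noneP.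
- move=> Y; rewrite inE => /andP[/GsetP[sY kY Y0] /first_noneP Yb].
  have sV := down_stable _ sY.
  apply: pt_inj;
    rewrite (regionK Nn1 sV)
    (regionK (Nn : N.+1 <= n.+1) (stable_glue_column sV)).
  apply/funext => -[|x]; apply/funext => -[|y] //=.
  apply/esym/negbTE/negP => Hy; move: (Hy); rewrite Yb //.
  by have := sY.1 _ _ Hy; lia.
- move=> V /FsetP[sV kV]; have sY := stable_glue_column sV.
  by apply: pt_inj;
    rewrite (regionK (Nn : N.+1 <= n.+1) sY) (regionK Nn1 (down_stable _ sY)).
Qed.

(** Here [i] is m - 1, and the pair lists the right piece first, then the upper one. The other
    bottom points number [k - rowsize p.1 i]: at least one because of (0, 0), and at most one more
    than the bottom row of the upper piece. *)
Definition above_pairs i e k : {set {set grid n} * {set grid n}} :=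
  [set p | [&& p.1 \in stable_sets n i, p.2 \in stable_sets n e, pt p.2 0 0,
    rowsize p.1 i < k & k - rowsize p.1 i <= (rowsize p.2 e).+1]].

Lemma above_pairsP i e k V U :
  reflect [/\ stable i (pt V), stable e (pt U), pt U 0 0,
             rowsize V i < k & k - rowsize V i <= (rowsize U e).+1]
          ((V, U) \in above_pairs i e k).
Proof.
rewrite inE /=; apply: (iffP and5P) => -[].
  by move=> /stable_setsP ? /stable_setsP.
by move=> ? ? ? ? ?; split=> //; apply/stable_setsP.
Qed.

Lemma card_Gset_fiber i e k : 0 < e -> i.+1 + e <= n.+1 ->
  #|[set Y in Gset n (i.+1 + e) k | column_gap Y (i + e) == i]| =
  #|above_pairs i e k|.
Proof.
move=> e0 Nn; set N := i.+1 + e.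
have en : e <= n.+1 by lia.
have iN : i <= n.+1 by lia.
have ie : i < i + e by lia.
have eN : e.+1 + i = N by rewrite /N; lia.
have up_stable P : stable N P -> stable e (fun x y => P x (i.+1 + y)).
  by apply: (@stable_shift 0 i.+1); rewrite /N; lia.
have right_stable P : stable N P -> stable i (fun x y => P (e.+1 + x) y).
  by apply: (@stable_shift e.+1 0); rewrite /N; lia.
have gapP (P : nat -> nat -> bool)
  : P 0 i.+1 /\ (forall y, y < i -> P 0 y.+1 = false) ->
    forall y, 0 < y < i.+1 -> P 0 y = false.
  by move=> [_ Pb] [|y] //=; rewrite ltnS => /Pb.
have splitY P : stable N P -> P 0 0 ->
    P 0 i.+1 /\ (forall y, y < i -> P 0 y.+1 = false) ->
    glue_above i.+1 e (cnt (P ^~ 0) e.+1)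
      (fun x y => P x (i.+1 + y)) (fun x y => P (e.+1 + x) y) = P.
  move=> sP P0 Pi; apply/funext => x; apply/funext => y.
  by apply: glue_above_split => //; [case: Pi | apply: gapP].
have glueU s P R : stable e P -> stable i R ->
    (fun x y => glue_above i.+1 e s P R x (i.+1 + y)) = P.
  move=> sP sR; apply/funext => x; apply/funext => y.
  by rewrite (@split_glue_above i.+1 e s P R).
have glueW s P R : stable e P -> stable i R ->
    (fun x y => glue_above i.+1 e s P R (e.+1 + x) y) = R.
  move=> sP sR; apply/funext => x; apply/funext => y.
  by rewrite (@split_glue_above i.+1 e s P R).
apply: (@card_bij _ _ _ _
  (fun Y => (region n (fun x y => pt Y (e.+1 + x) y),
             region n (fun x y => pt Y x (i.+1 + y))))
  (fun p => region n
    (glue_above i.+1 e (k - rowsize p.1 i) (pt p.2) (pt p.1)))).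
- move=> Y; rewrite inE => /andP[/GsetP[sY kY Y0] /(firstP _ ie)[Yi Yb]].
  have sU := up_stable _ sY; have sW := right_stable _ sY.
  have eqY := splitY _ sY Y0 (conj Yi Yb).
  apply/above_pairsP; rewrite /rowsize (regionK en sU) (regionK iN sW).
  have kE : k = cnt (pt Y ^~ 0) e.+1 + cnt (fun x => pt Y (e.+1 + x) 0) i.
    by rewrite -kY /rowsize -eN cntD.
  split=> //; first by rewrite addn0.
    by rewrite kE -[X in X < _]add0n ltn_add2r lt0n;
      apply/negP => /cnt0P/(_ 0 (ltn0Sn _)); rewrite Y0.
  rewrite kE addnK; set t := cnt _ e.+1 in eqY *.
  (* Since [Y] is its own regluing, this count reads [t = minn t (|T| + 1)], with T the bottom row
     of the upper piece, and so bounds [t]. *)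
  have := cnt_glue_above e t (fun x y => pt Y x (i.+1 + y))
    (fun x y => pt Y (e.+1 + x) y) (ltn0Sn i).
  by rewrite eqY -/t => ->; exact: geq_minr.
- move=> [V U] /above_pairsP[sV sU U0 kV kU] /=.
  have sY := @stable_glue_above i.+1 e (k - rowsize V i) _ _ (ltn0Sn _) sU sV.
  rewrite inE /column_gap; apply/andP; split.
    apply/GsetP; rewrite /rowsize (regionK Nn sY); split=> //.
      rewrite -eN cntD cnt_glue_above // (minn_idPl kU).
      rewrite (@eq_cnt _ (pt V ^~ 0)) ?subnK //; first exact: ltnW.
      by move=> x _; rewrite (@split_glue_above i.+1 e _ (pt U) (pt V)).
    by rewrite /glue_above /= U0 subn_gt0 kV.
  rewrite (regionK Nn sY); apply/(firstP _ ie).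
  rewrite /glue_above leqnn subnn U0; split=> // y yi.
  by rewrite ltnS leqNgt yi.
- move=> Y; rewrite inE => /andP[/GsetP[sY kY Y0] /(firstP _ ie)[Yi Yb]].
  have sU := up_stable _ sY; have sW := right_stable _ sY.
  apply: pt_inj; rewrite /= /rowsize (regionK en sU) (regionK iN sW).
  have -> : k - cnt (fun x => pt Y (e.+1 + x) 0) i = cnt (pt Y ^~ 0) e.+1.
    by rewrite -kY /rowsize -eN cntD addnK.
  by rewrite splitY // (regionK Nn sY).
- move=> [V U] /above_pairsP[sV sU U0 kV kU] /=.
  have sY := @stable_glue_above i.+1 e (k - rowsize V i) _ _ (ltn0Sn _) sU sV.
  congr (_, _); apply: pt_inj; rewrite (regionK Nn sY).
    by rewrite (regionK iN (right_stable _ sY)) glueW.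
  by rewrite (regionK en (up_stable _ sY)) glueU.
Qed.

(** Sort by the bottom size [r] of the right piece. The upper piece then needs [k + 1 - r <= q + 1],
    whence the lower limit [k - r]. *)
Lemma card_above_pairs i e k :
  #|above_pairs i e k.+1| = \sum_(0 <= r < (minn i k).+1)
     #|Fset n i r| * \sum_(k - r <= q < e.+1) #|Gset n e q|.
Proof.
rewrite (@card_fibers _ _ (fun p => rowsize p.1 i) 0 (minn i k).+1); last first.
  move=> [V U] /above_pairsP[_ _ _ kV _] /=.
  by rewrite ltnS leq_min leq_cnt -ltnS.
apply: eq_big_nat => r /=; rewrite ltnS leq_min => /andP[ri rk].
pose B := [set U in stable_sets n e | pt U 0 0 && (k - r <= rowsize U e)].
transitivity #|setX (Fset n i r) B|.
  apply: eq_card => -[V U]; rewrite [LHS]inE in_setX.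
  apply/andP/andP => [[/above_pairsP[sV sU U0 kV kU] /eqP kr]|].
    rewrite /= in kr; split; first exact/FsetP.
    rewrite inE U0; apply/andP; split; first exact/stable_setsP.
    by move: kU; rewrite kr /=; lia.
  case=> /FsetP[sV kV]; rewrite inE => /and3P[/stable_setsP sU U0 kU].
  by split; [apply/above_pairsP; split => // | apply/eqP => //]; lia.
rewrite cardsX; congr (_ * _).
rewrite (@card_fibers _ _ (fun U => rowsize U e) (k - r) e.+1); last first.
  by move=> U; rewrite inE => /and3P[_ _ ->]; rewrite ltnS leq_cnt.
apply: eq_big_nat => q /andP[rq qe]; apply: eq_card => U.
apply/setIdP/GsetP => [[]|[sU kU U0]].
  by rewrite inE => /and3P[/stable_setsP ? ? _] /eqP.
split; last exact/eqP.
by rewrite inE U0 kU rq !andbT; apply/stable_setsP.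
Qed.

Lemma card_Gset N k : N <= n ->
  #|Gset n N.+1 k.+1| = #|Fset n N k| + \sum_(0 <= i < N)
    \sum_(0 <= r < (minn i k).+1)
     #|Fset n i r| * \sum_(k - r <= q < (N - i).+1) #|Gset n (N - i) q|.
Proof.
move=> Nn.
rewrite (@card_fibers _ _ (fun Y => column_gap Y N) 0 N.+1); last first.
  by move=> Y _ /=; rewrite ltnS first_leq.
rewrite big_nat_recr //= addnC card_Gset_column //; congr (_ + _).
apply: eq_big_nat => i /andP[_ iN]; rewrite -card_above_pairs.
rewrite -card_Gset_fiber ?subn_gt0 //; last lia.
by rewrite subnKC ?addSn ?subnKC // ltnW.
Qed.

End Counting.

(** * Identification of the counts with the given recursive functions *)

Lemma card_Fset_out n N k : N < k -> #|Fset n N k| = 0.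
Proof.
move=> Nk; apply: eq_card0 => Y; apply/negbTE/negP => /FsetP[_ kY].
by have := leq_cnt (pt Y ^~ 0) N; rewrite -/(rowsize _ _) kY leqNgt Nk.
Qed.

Lemma card_Gset_out n N k : (k == 0) || (N < k) -> #|Gset n N k| = 0.
Proof.
move=> Nk; apply: eq_card0 => Y; apply/negbTE/negP => /GsetP[[sup _] kY Y0].
case/orP: Nk => [/eqP k0|Nk]; last first.
  by have := leq_cnt (pt Y ^~ 0) N; rewrite -/(rowsize _ _) kY leqNgt Nk.
have : rowsize Y N == 0 by rewrite kY k0.
by move/cnt0P/(_ 0 (sup _ _ Y0)); rewrite Y0.
Qed.

Import GRing.Theory Num.Theory.
Local Open Scope ring_scope.

Lemma row_sumE (f : int -> int -> int) (n L : nat) :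
  (forall i : int, (i < 0) || (L%:Z <= i) -> f n i = 0) ->
  row_sum f n = \sum_(0 <= i < L) f n i%:Z.
Proof.
move=> f0; rewrite /row_sum (@fsbigE _ _ _ _ _ (map Posz (iota 0 L))).
- by rewrite big_map /index_iota subn0; apply: eq_bigl => i;
    rewrite classical_sets.in_setT.
- by rewrite map_inj_uniq ?iota_uniq // => x y [].
- by [].
move=> [] i _ /negP iL; apply: f0; last by [].
have [iL'|] := ltnP i L; last by lia.
by case: iL; rewrite mem_map ?mem_iota // => x y [].
Qed.

Lemma Posz_sum (L K : nat) (F : nat -> nat) :
  (\sum_(K <= i < L) F i)%N%:Z = \sum_(K <= i < L) (F i)%:Z.
Proof. exact: (big_morph Posz PoszD). Qed.

(** Strong induction on [N], starting from row -1, where the empty set is the only stable set. *)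
Lemma ab_count (a b : int -> int -> int) (Hab : ab_system a b) (n N : nat) :
  (N <= n.+1)%N ->
  (forall k : nat, a (N%:Z - 1) k%:Z = #|Fset n N k|%:Z) /\
  (forall k : nat, b (N%:Z - 1) k%:Z = #|Gset n N k|%:Z).
Proof.
elim/ltn_ind: N => N IH Nn.
case: N IH Nn => [|N] IH Nn.
  split=> k.
    case: k => [|k]; last by rewrite card_Fset_out // (a_neg Hab).
    have := card_stable_sets n 0.
    by rewrite big_nat1 stable_sets0 cards1 => <-; rewrite sub0r (a_m1_0 Hab).
  by rewrite (b_out Hab) ?card_Gset_out //; lia.
have -> : N.+1%:Z - 1 = N%:Z by lia.
have aE M k : (M <= N)%N -> a (M%:Z - 1) k%:Z = #|Fset n M k|%:Z.
  by move=> MN; rewrite (IH M _ _).1 //; lia.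
have bE M k : (M <= N)%N -> b (M%:Z - 1) k%:Z = #|Gset n M k|%:Z.
  by move=> MN; rewrite (IH M _ _).2 //; lia.
(* [b] comes first: its recurrence uses only earlier rows, whereas that of [a] uses the current row
   of [b]. *)
have bN (k : nat) : b N%:Z k%:Z = #|Gset n N.+1 k|%:Z.
  case: k => [|k]; first by rewrite (b_out Hab) // card_Gset_out.
  have [Nk|kN] := ltnP N k; first by rewrite (b_out Hab) ?card_Gset_out //; lia.
  rewrite card_Gset // PoszD Posz_sum.
  (* The recurrences start at row 1, so row 0 is checked against the initial values. *)
  case: (posnP N) => [N0|N0].
    subst N; have -> : k = 0%N by lia.
    by rewrite big_nil addr0 (b_0_1 Hab) -aE // (a_m1_0 Hab).
  rewrite (b_rec Hab) //; last by lia.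
  have -> : k.+1%:Z - 1 = k%:Z by lia.
  rewrite aE // big_add1 /=; congr (_ + _).
  apply: eq_big_nat => i /andP[_ iN].
  rewrite !subn1 /= Posz_sum; apply: eq_big_nat => r _.
  rewrite PoszM Posz_sum.
  have -> : i.+1%:Z - 2 = i%:Z - 1 by lia.
  rewrite aE; last by lia.
  congr (_ * _); rewrite addn1 subnSK //.
  apply: eq_big_nat => q _.
  have -> : N%:Z - i.+1%:Z = (N - i)%N%:Z - 1 by lia.
  by rewrite bE //; lia.
split=> // -[|k].
  rewrite card_Fset0 // card_stable_sets Posz_sum.
  case: (posnP N) => [N0|N0].
    by subst N; rewrite big_nat1 -aE // (a_m1_0 Hab) (a_0_0 Hab).
  rewrite (a_rec0 Hab) //; apply: eq_big_nat => i _; exact: aE.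
rewrite card_Fset // PoszD Posz_sum -bN /=.
case: (posnP N) => [N0|N0].
  subst N; rewrite big_nil addr0; case: k => [|k].
    by rewrite (a_0_1 Hab) (b_0_1 Hab).
  by rewrite (a_large Hab) ?(b_out Hab) //; lia.
rewrite (a_rec Hab) // subn1 prednK //; congr (_ + _).
apply: eq_big_nat => j /andP[_ jN]; rewrite PoszM -bE //.
have -> : j.+1%:Z - 1 = j%:Z by lia.
congr (_ * _); rewrite card_stable_sets Posz_sum.
have -> : (N.+1 - j).-2 = (N - j - 1)%N by lia.
apply: eq_big_nat => i _.
have -> : N%:Z - j%:Z - 2 = (N - j - 1)%N%:Z - 1 by lia.
by apply: aE; lia.
Qed.

Theorem theoremA (a b : int -> int -> int) (Hab : ab_system a b) (n : nat) :
  (#|Rset n|%:Z = row_sum a n%:Z) /\ (#|Pset n|%:Z = row_sum b n%:Z).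
Proof.
have [aE bE] := ab_count Hab (leqnn n.+1).
have nE : n.+1%:Z - 1 = n%:Z by lia.
rewrite nE in aE bE; rewrite !(@row_sumE _ n n.+2); last 2 first.
- by move=> i i0; rewrite (b_out Hab) //; lia.
- move=> i /orP[i0|ni]; first by rewrite (a_out Hab) // i0.
  by rewrite (a_large Hab) //; lia.
split.
  rewrite Rset_stable card_stable_sets Posz_sum.
  by apply: eq_big_nat => k _; rewrite aE.
rewrite (@card_fibers _ _ (fun Y => rowsize Y n.+1) 0 n.+2) => [|Y _];
  last first.
  by rewrite ltnS leq_cnt.
rewrite Posz_sum; apply: eq_big_nat => k _; rewrite bE; congr Posz.
apply: eq_card => Y; rewrite /Pset Rset_stable.
apply/setIdP/GsetP => [[/setIdP[/stable_setsP sY Y0] /eqP kY]|[sY kY Y0]].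
  by split=> //; rewrite -(ptE Y) in Y0.
split; last exact/eqP.
by apply/setIdP; split; [apply/stable_setsP|rewrite -(ptE Y)].
Qed.
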